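(* Let $\mathcal{A}$ be a countable relational structure which is $\omega$-well structured and totally ordered, and let $\mathbb{K}$ be a Noetherian commutative ring. Then the polynomial ring $\mathbb{K}[\mathcal{A}]$ is equivariantly Noetherian.
   Context: A relational structure $\mathcal{A}=(A,r_1,\dots,r_n)$ is a countable set $A$ with finitely many relations $r_i\subseteq A^{s_i}$; a relation is definable if it is a Boolean combination of $r_1,\dots,r_n$, and equality is always assumed definable. $\mathcal{A}$ is totally ordered if some total order on $A$ is definable. An embedding of $\mathcal{A}$ is a map $\iota:A\to A$ preserving and reflecting every $r_i$; $\mathrm{Emb}(\mathcal{A})$ is the set of embeddings. $\mathbb{K}[\mathcal{A}]$ is the ring of polynomials over $\mathbb{K}$ with variables the elements of $A$; $\iota\in\mathrm{Emb}(\mathcal{A})$ acts on polynomials by renaming variables $a\mapsto\iota(a)$. An ideal $\mathcal{I}$ is equivariant if it is closed under this action; a basis of an equivariant ideal $\mathcal{I}$ is a subset $\mathcal{B}\subseteq\mathcal{I}$ such that every element of $\mathcal{I}$ is of the form $\sum_i h_i\cdot\iota_i(g_i)$ with $g_i\in\mathcal{B}$, $h_i\in\mathbb{K}[\mathcal{A}]$, $\iota_i\in\mathrm{Emb}(\mathcal{A})$; $\mathbb{K}[\mathcal{A}]$ is equivariantly Noetherian if every equivariant ideal has a finite basis. A wqo is a quasi order in which every infinite sequence $y_1,y_2,\dots$ has $i<j$ with $y_i\preceq y_j$. For labellings $\ell:B\to\mathbb{N}$, $\ell':B'\to\mathbb{N}$ of finite subsets of $A$, write $\ell\rightsquigarrow\ell'$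 if some $\iota\in\mathrm{Emb}(\mathcal{A})$ has $\iota(B)\subseteq B'$ and $\ell(b)\le\ell'(\iota(b))$ for all $b\in B$; $\mathcal{A}$ is $\omega$-well structured if $\rightsquigarrow$ is a wqo. *)

(* Defs.v *)
From mathcomp Require Import all_boot all_algebra.
From mathcomp Require Import finmap.
From mathcomp.multinomials Require Import monalg.

Set Implicit Arguments.
Unset Strict Implicit.
Unset Printing Implicit Defensive.

Import GRing.Theory.

Local Open Scope ring_scope.

Record relStructure (A : countType) := RelStructure {
  nrel : nat;
  arity : 'I_nrel -> nat;
  rel_of : forall i : 'I_nrel, (arity i).-tuple A -> Prop
}.

(* Boolean combinations of the basic relations with free variables x_0, ...,
   x_(k-1).  The variables of an atom r_i(x_{v_1}, ..., x_{v_s}) may be chosen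
   freely, since the basic relations need not have the same arity.  Equality
   is not an atom: its definability is a separate assumption. *)
Inductive boolComb (A : countType) (S : relStructure A) (k : nat) : Type :=
| BTrue
| BAtom (i : 'I_(nrel S)) (v : (arity i).-tuple 'I_k)
| BNot (f : boolComb S k)
| BAnd (f g : boolComb S k).

Fixpoint bsat (A : countType) (S : relStructure A) (k : nat)
    (f : boolComb S k) (t : k.-tuple A) : Prop :=
  match f with
  | BTrue => True
  | BAtom i v => rel_of [tuple of map (tnth t) v]
  | BNot f => ~ bsat f t
  | BAnd f g => bsat f t /\ bsat g t
  end.

Definition definable (A : countType) (S : relStructure A) (k : nat)
    (P : k.-tuple A -> Prop) : Prop :=
  exists f : boolComb S k, forall t, P t <-> bsat f t.

Definition definable2 (A : countType) (S : relStructure A)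
    (P : A -> A -> Prop) : Prop :=
  definable S (fun t : 2.-tuple A => P (tnth t ord0) (tnth t ord_max)).

Definition total_order (A : Type) (le : A -> A -> Prop) : Prop :=
  [/\ forall x, le x x,
      forall x y, le x y -> le y x -> x = y,
      forall x y z, le x y -> le y z -> le x z
    & forall x y, le x y \/ le y x].

Definition totally_ordered (A : countType) (S : relStructure A) : Prop :=
  exists le : A -> A -> Prop, total_order le /\ definable2 S le.

Definition is_embedding (A : countType) (S : relStructure A)
    (iota : A -> A) : Prop :=
  forall (i : 'I_(nrel S)) (t : (arity i).-tuple A),
    rel_of [tuple of map iota t] <-> rel_of t.

Definition wqo (T : Type) (le : T -> T -> Prop) : Prop :=
  [/\ forall x, le x x,
      forall x y z, le x y -> le y z -> le x z
    & forall y : nat -> T, exists i j : nat, (i < j)%N /\ le (y i) (y j)].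

(* A labelling B -> nat of a finite subset B of A is a finite map whose domain
   domf is B. *)
Definition lab_le (A : countType) (S : relStructure A)
    (l l' : {fmap A -> nat}) : Prop :=
  exists2 iota : A -> A, is_embedding S iota &
    forall b : domf l, exists ib : iota (val b) \in domf l',
      (l b <= l' [` ib]%fset)%N.

Definition omega_well_structured (A : countType) (S : relStructure A) : Prop :=
  wqo (lab_le S).

Definition is_ideal (R : comNzRingType) (I : R -> Prop) : Prop :=
  [/\ I 0,
      forall x y, I x -> I y -> I (x + y)
    & forall a x, I x -> I (a * x)].

Definition noetherian (R : comNzRingType) : Prop :=
  forall I : R -> Prop, is_ideal I ->
    exists (n : nat) (g : 'I_n -> R), (forall i, I (g i)) /\
      forall x, I x -> exists h : 'I_n -> R, x = \sum_(i < n) h i * g i.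

(* K[A]: finitely supported K-linear combinations of finitely supported
   monomials in the variables A. *)
Definition polyA (K : comNzRingType) (A : countType) : comNzRingType :=
  {malg K[{cmonom A}]}.

Definition varA (K : comNzRingType) (A : countType) (a : A) : polyA K A :=
  << ucm a >>.

Definition rename (K : comNzRingType) (A : countType) (iota : A -> A)
    (p : polyA K A) : polyA K A :=
  mmap (fun c : K => c%:MP : polyA K A)
       (fun m : {cmonom A} =>
          \prod_(a <- finsupp m) varA K (iota a) ^+ m a) p.

Definition equivariant_ideal (K : comNzRingType) (A : countType)
    (S : relStructure A) (I : polyA K A -> Prop) : Prop :=
  is_ideal I /\
  forall (iota : A -> A) (p : polyA K A),
    is_embedding S iota -> I p -> I (rename iota p).

Definition equivariant_basis (K : comNzRingType) (A : countType)
    (S : relStructure A) (I B : polyA K A -> Prop) : Prop :=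
  (forall g, B g -> I g) /\
  forall f, I f ->
    exists (n : nat) (h g : 'I_n -> polyA K A) (iota : 'I_n -> A -> A),
      [/\ forall i, B (g i),
          forall i, is_embedding S (iota i)
        & f = \sum_(i < n) h i * rename (iota i) (g i)].

Definition equivariantly_noetherian (K : comNzRingType) (A : countType)
    (S : relStructure A) : Prop :=
  forall I : polyA K A -> Prop, equivariant_ideal S I ->
    exists s : seq (polyA K A), equivariant_basis S I (fun g => g \in s).

(* Main.v *)
Require Import Defs.
From mathcomp Require Import all_boot all_algebra.
From mathcomp Require Import finmap boolp.
From mathcomp.multinomials Require Import monalg.

(* Embeddings are injective and preserve a definable total order of A, hence
   also the order on monomials that compares exponents at the largest variable
   where they differ.  If an equivariant ideal I had no finite basis, choose
   f_0, f_1, ... in I successively so that f_n is not generated by its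
   predecessors and has the least leading monomial m_n among such polynomials
   with variables in a finite set V_n.  Label V_n by the exponents of m_n.
   Along a subsequence the labels increase, so that m_n is a multiple of a
   renaming of m_i for every i < n, where the renaming maps V_i into V_n; and as
   K is Noetherian, some leading coefficient is a combination of the earlier
   ones.  Subtracting the corresponding multiples of renamed f_i from f_n
   introduces no variable outside V_n and cancels the leading term,
   contradicting the choice of f_n. *)

Set Implicit Arguments.
Unset Strict Implicit.
Unset Printing Implicit Defensive.

Import GRing.Theory.

Local Open Scope ring_scope.

(** * Embeddings and definable relations *)

Section Embeddings.
Context (A : countType) (S : relStructure A) (iota : A -> A).
Hypothesis iota_emb : is_embedding S iota.

Lemma bsat_embedding k (f : boolComb S k) (t : k.-tuple A) :
  bsat f [tuple of map iota t] <-> bsat f t.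
Proof.
elim: f => [|i v|f IHf|f IHf g IHg] //=; last 2 first.
- by rewrite IHf.
- by rewrite IHf IHg.
rewrite -(iota_emb [tuple of map (tnth t) v]).
suff -> : [tuple of map (tnth [tuple of map iota t]) v] =
          [tuple of map iota [tuple of map (tnth t) v]] by [].
by apply: eq_from_tnth => j; rewrite !tnth_map.
Qed.

(** Applied to equality this makes embeddings injective; applied to the definable order it makes
    them monotone. *)
Lemma definable2_embedding (P : A -> A -> Prop) x y :
  definable2 S P -> P (iota x) (iota y) <-> P x y.
Proof.
move=> [f Pf]; have := bsat_embedding f [tuple x; y].
by rewrite -!Pf !(tnth_nth x).
Qed.

End Embeddings.

(** * Sequences in well-quasi-orders and in Noetherian rings *)

Section IncreasingSubsequence.
Context (T : Type) (le : T -> T -> Prop).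
Hypothesis le_wqo : wqo le.

(* Otherwise the indices from which no step up is possible form a bad
   subsequence. *)
Lemma wqo_good_tail (y : nat -> T) :
  exists N, forall i, (N <= i)%N -> exists2 j, (i < j)%N & le (y i) (y j).
Proof.
have [_ _ good] := le_wqo; apply: contrapT => bad.
have step N : exists i, (N <= i)%N /\ forall j, (i < j)%N -> ~ le (y i) (y j).
  apply: contrapT => noi; apply: bad; exists N => i Ni.
  apply: contrapT => noj; apply: noi; exists i; split=> // j ij lij.
  by apply: noj; exists j.
have [g gP] := choice step.
pose s := fix s n := if n is n'.+1 then g (s n').+1 else g 0%N.
have s_lt : {homo s : m n / (m < n)%N}.
  by apply: homo_ltn; [exact: ltn_trans | move=> n; have [] := gP (s n).+1].
have s_bad n j : (s n < j)%N -> ~ le (y (s n)) (y j).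
  by case: n => [|n]; apply: (gP _).2.
have [i [j [ij lij]]] := good (y \o s).
exact: s_bad (s_lt _ _ ij) lij.
Qed.

Lemma wqo_increasing_subsequence (y : nat -> T) :
  exists s : nat -> nat, forall i j, (i < j)%N ->
    (s i < s j)%N /\ le (y (s i)) (y (s j)).
Proof.
have [_ le_trans _] := le_wqo.
have [N goodN] := wqo_good_tail y.
have step i : exists j, (N <= i)%N -> (i < j)%N /\ le (y i) (y j).
  have [/goodN[j ij lij]|//] := boolP (N <= i)%N; first by exists j.
  (* An arbitrary value below [N], so that [choice] yields a total function. *)
  by exists 0%N.
have [g gP] := choice step.
pose s := fix s n := if n is n'.+1 then g (s n') else N.
have sN n : (N <= s n)%N.
  by elim: n => //= n IHn; apply: leq_trans IHn (ltnW (gP _ IHn).1).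
exists s; apply: (homo_ltn (r := fun i j => (i < j)%N /\ le (y i) (y j))) =>
  [j i k [ij lij] [jk ljk]|i]; last exact/gP/sN.
by split; [apply: ltn_trans ij jk | apply: le_trans lij ljk].
Qed.

End IncreasingSubsequence.

(** The ideals [J n] spanned by the first [n] terms increase. Their union is finitely generated,
    hence equals some [J N], and [c N] lies in the union. *)
Lemma noetherian_sequence (K : comNzRingType) (c : nat -> K) :
  noetherian K ->
  exists (n : nat) (d : nat -> K), c n = \sum_(i < n) d i * c i.
Proof.
move=> noethK; pose J n x := exists d : nat -> K, x = \sum_(i < n) d i * c i.
have Jsub m n x : (m <= n)%N -> J m x -> J n x.
  move=> mn [d ->]; exists (fun i => if (i < m)%N then d i else 0).
  rewrite (big_ord_widen _ (fun i => d i * c i) mn) big_mkcond.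
  by apply: eq_bigr => i _; case: ifP => // _; rewrite mul0r.
have JD n x y : J n x -> J n y -> J n (x + y).
  move=> [d ->] [e ->]; exists (fun i => d i + e i).
  by rewrite -big_split; apply: eq_bigr => i _; rewrite mulrDl.
have JM n a x : J n x -> J n (a * x).
  move=> [d ->]; exists (fun i => a * d i).
  by rewrite big_distrr; apply: eq_bigr => i _; rewrite /= mulrA.
have J0 n : J n 0.
  by exists (fun=> 0); rewrite big1 // => i _; rewrite mul0r.
have [|n [g [Jg gen]]] := noethK (fun x => exists n, J n x).
  split; first by exists 0%N.
  - move=> x y [m Jx] [n Jy]; exists (maxn m n).
    by apply: JD; [apply: Jsub Jx; rewrite leq_maxl
                  |apply: Jsub Jy; rewrite leq_maxr].
  - by move=> a x [m Jx]; exists m; apply: JM.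
have [h hP] := choice Jg.
pose N := \max_i h i; exists N.
have [|a ->] := gen (c N).
  exists N.+1, (fun i => (i == N)%:R).
  rewrite big_ord_recr /= eqxx mul1r big1 ?add0r // => i _.
  by rewrite ltn_eqF ?mul0r.
rewrite -/(J N _); apply: big_ind => [|x y|i _]; [exact: J0 | exact: JD |].
by apply/JM/(Jsub (h i)); rewrite ?leq_bigmax.
Qed.

(** * The lexicographic order on monomials *)

Section MonomialOrder.
Context (A : choiceType) (leA : rel A).
Hypotheses (leA_total : total leA) (leA_trans : transitive leA).
Hypothesis leA_anti : antisymmetric leA.
Implicit Types (m : {cmonom A}) (V : {fset A}).

Definition mlt m m' :=
  exists a, (m a < m' a)%N /\ forall b, b != a -> leA a b -> m b = m' b.


(** The larger of the two deciding variables decides the outer comparison. *)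
Lemma mlt_trans m1 m2 m3 : mlt m1 m2 -> mlt m2 m3 -> mlt m1 m3.
Proof.
move=> [a [ma eqa]] [b [mb eqb]].
have [eab|neq] := eqVneq a b.
  subst b; exists a; split=> [|c neq ac]; first exact: ltn_trans ma mb.
  by rewrite eqa ?eqb.
have [ab|ba] := orP (leA_total a b).
  exists b; split=> [|c neqc bc]; first by rewrite eqa // eq_sym.
  rewrite eqa ?eqb //; last exact: leA_trans bc.
  apply: contraNneq neq => eca; subst c; apply/eqP/leA_anti.
  by rewrite ab.
exists a; split=> [|c neqc ac]; first by rewrite -eqb.
rewrite eqa ?eqb //; last exact: leA_trans ac.
apply: contraNneq neq => ecb; subst c; apply/eqP/leA_anti.
by rewrite ba ac.
Qed.

Lemma mlt_total m m' : m != m' -> mlt m m' \/ mlt m' m.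
Proof.
move=> neq; pose geA x y := leA y x.
have geA_trans : transitive geA by move=> y x z /= yx zy; apply: leA_trans yx.
have geA_total : total geA by move=> x y; apply: leA_total.
(* Sorted decreasingly, so the head is the largest variable where [m] and [m'] differ. *)
pose s := sort geA [seq a <- finsupp m `|` finsupp m' | m a != m' a]%fset.
have s_mem a : (a \in s) = (m a != m' a).
  rewrite mem_sort mem_filter inE andb_idr // => neqa.
  by rewrite -!cmE_neq0; case: (m a) neqa => //; rewrite eq_sym.
have := sort_sorted geA_total [seq a <- finsupp m `|` finsupp m' | m a != m' a]%fset.
rewrite -/s; case: s s_mem => [|a s] s_mem /=.
  case/negP: neq; apply/cmP => a; apply/eqP.
  by have := s_mem a; case: eqP.
move=> /(order_path_min geA_trans)/allP smax.
have eqm b : b != a -> leA a b -> m b = m' b.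
  move=> neqb ab; apply/eqP; apply: contraNT neqb.
  rewrite -s_mem inE => /predU1P[-> //|/smax ba].
  by apply/eqP/leA_anti; rewrite ab andbT.
have := s_mem a; rewrite mem_head neq_ltn => /esym/orP[lt_m|lt_m].
  by left; exists a.
by right; exists a; split=> // b neqb ab; rewrite eqm.
Qed.

Lemma mlt_max (s : seq {cmonom A}) : s != [::] ->
  exists2 m, m \in s & forall m', m' \in s -> m' = m \/ mlt m' m.
Proof.
elim: s => // m s IHs _; have [->|/IHs[m1 m1s m1max]] := eqVneq s [::].
  by exists m => [|m']; rewrite inE // => /eqP->; left.
have [eqm|neq] := eqVneq m m1.
  exists m => [|m']; rewrite inE ?eqxx // => /predU1P[-> |]; first by left.
  by rewrite eqm; apply: m1max.
have [lt_m|lt_m] := mlt_total neq.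
  by exists m1 => [|m']; rewrite inE ?m1s ?orbT // => /predU1P[-> |/m1max]; auto.
exists m => [|m']; rewrite inE ?eqxx // => /predU1P[-> |/m1max[->|]]; auto.
by right; apply: mlt_trans lt_m.
Qed.

(** Minimise the exponent at the largest variable of [V], then, among the minimisers, the exponent
    at the next one, and so on through the finite set. *)
Lemma mlt_min V (P : {cmonom A} -> Prop) :
  (exists m, P m) -> (forall m, P m -> {subset finsupp m <= V}) ->
  exists2 m, P m & forall m', P m' -> ~ mlt m' m.
Proof.
pose geA x y := leA y x.
have geA_trans : transitive geA by move=> y x z /= yx zy; apply: leA_trans yx.
have geA_total : total geA by move=> x y; apply: leA_total.
move=> exP PV.
suff [m Pm min_m] : exists2 m, P m & forall m', P m' -> forall a, a \in V ->
    (m' a < m a)%N -> ~ forall b, b \in V -> b != a -> leA a b -> m' b = m b.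
  exists m => // m' Pm' [a [lt_a eqm]]; apply: (min_m m' Pm' a) => [|//|b _].
    by apply: (PV m); rewrite // -cmE_neq0 -lt0n (leq_ltn_trans _ lt_a).
  exact: eqm.
have := sort_sorted geA_total V; move: exP {PV}.
(* [Q] is general because the induction on [s] restricts it to the minimisers found so far. *)
suff min_on s : forall Q : {cmonom A} -> Prop, (exists m, Q m) -> sorted geA s ->
    exists2 m, Q m & forall m', Q m' -> forall a, a \in s ->
    (m' a < m a)%N -> ~ forall b, b \in s -> b != a -> leA a b -> m' b = m b.
  move=> exP sV; have [m Pm min_m] := min_on _ _ exP sV.
  exists m => // m' Pm' a aV lt_a eqm; apply: (min_m m' Pm' a).
  - by rewrite mem_sort.
  - by [].
  - by move=> b; rewrite mem_sort; apply: eqm.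
elim: s => [|x s IHs] Q [m0 Qm0] /=; first by exists m0.
move=> xs; have /allP smax := order_path_min geA_trans xs.
have exn : exists n, `[< exists2 m, Q m & m x = n >].
  by exists (m0 x); apply/asboolP; exists m0.
have [n /asboolP[m1 Qm1 m1x] min_n] := ex_minnP exn.
have [|m [Qm mx] min_m] := IHs (fun m => Q m /\ m x = n) _ (path_sorted xs).
  by exists m1.
exists m => // m' Qm' a; rewrite inE => /predU1P[-> |a_s] lt_a eqm.
  have /min_n : `[< exists2 m, Q m & m x = m' x >] by apply/asboolP; exists m'.
  by rewrite -mx leqNgt lt_a.
(* Being [sorted] does not exclude that [x] occurs again in [s]. *)
have [eax|neq] := eqVneq x a.
  subst x; have /min_n : `[< exists2 m, Q m & m a = m' a >].
    by apply/asboolP; exists m'.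
  by rewrite -mx leqNgt lt_a.
apply: (min_m m' _ a a_s lt_a) => [|b bs]; last by apply: eqm; rewrite inE bs orbT.
split=> //; rewrite -mx; apply: eqm; rewrite ?mem_head //.
exact: smax.
Qed.

End MonomialOrder.

(** * Renaming variables in monomials and polynomials *)

Lemma mmul_inj (A : choiceType) (q : {cmonom A}) : injective (mmul q).
Proof.
move=> m m' eqm; apply/eqP/cmP => a.
by apply/(@addnI (q a)); rewrite -!cmM eqm.
Qed.

Section Renaming.
Context (K : comNzRingType) (A : countType) (iota : A -> A).
Hypothesis iota_inj : injective iota.
Implicit Types (m q : {cmonom A}) (p : {malg K[{cmonom A}]}).

(** Mirrors the product in the body of [rename], with powers unfolded, so that [renameE] follows
    from multiplicativity of [<< _ >>]. *)
Definition rename_monom m : {cmonom A} :=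
  \big[mmul/mone]_(a <- finsupp m) \big[mmul/mone]_(i < m a) ucm (iota a).

Lemma rename_monomE m b :
  rename_monom m b = (\sum_(a <- finsupp m) m a * (iota a == b))%N.
Proof.
have cm_big := big_morph (fun m : {cmonom A} => m b) (cmM b) (cm1 b).
rewrite /rename_monom cm_big; apply: eq_bigr => a _.
by rewrite cm_big (eq_bigr _ (fun _ _ => cmU _ _)) sum_nat_const card_ord.
Qed.

Lemma rename_monom_image m a : rename_monom m (iota a) = m a.
Proof.
rewrite rename_monomE.
rewrite (eq_bigr (fun b => if b == a then m a else 0%N)); last first.
  by move=> b _; rewrite (inj_eq iota_inj); case: eqP => [->|]; rewrite ?muln1 ?muln0.
have [am|am] := boolP (a \in finsupp m).
  rewrite (big_fsetD1 a) //= eqxx big1_seq ?addn0 // => b /=.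
  by rewrite !inE => /andP[/negPf->].
rewrite big1_seq => [|b /= bm]; first by apply/esym/eqP; rewrite cmE_eq0.
by case: eqP => // eba; rewrite -eba bm in am.
Qed.

Lemma rename_monom_notin m b :
  (forall a, iota a != b) -> rename_monom m b = 0%N.
Proof.
by move=> nb; rewrite rename_monomE big1 // => a _; rewrite (negPf (nb a)) muln0.
Qed.

Lemma rename_monom_neq0 m b :
  rename_monom m b != 0%N -> exists2 a, b = iota a & m a != 0%N.
Proof.
have [[a ->]|nb] := pselect (exists a, b = iota a).
  by rewrite rename_monom_image; exists a.
by rewrite rename_monom_notin // => a; apply: contra_notN nb => /eqP <-; exists a.
Qed.

Lemma rename_monom_inj : injective rename_monom.
Proof.
move=> m m' eqm; apply/eqP/cmP => a.
by rewrite -(rename_monom_image m) eqm rename_monom_image.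
Qed.

Lemma rename_monom_mlt (leA : rel A) m m' :
  {mono iota : a b / leA a b} ->
  mlt leA m m' -> mlt leA (rename_monom m) (rename_monom m').
Proof.
move=> iota_mono [a [lt_a eqm]]; exists (iota a).
rewrite !rename_monom_image; split=> // b neq ab.
have [[c eqb]|nb] := pselect (exists c, b = iota c).
  subst b; rewrite !rename_monom_image eqm //.
    by apply: contraNneq neq => ->.
  by rewrite -iota_mono.
by rewrite !rename_monom_notin // => c; apply: contra_notN nb => /eqP <-; exists c.
Qed.

Lemma malgUM (c d : K) m q :
  << c *g m >> * << d *g q >> = << c * d *g mmul m q >> :> {malg K[{cmonom A}]}.
Proof. by rewrite malgM_def fgmulUU. Qed.

Lemma renameE p :
  rename iota p = \sum_(m <- msupp p) << p@_m *g rename_monom m >>.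
Proof.
rewrite /rename mmapE; apply: eq_bigr => m _.
have prodU : {morph (fun q => << q >> : {malg K[{cmonom A}]}) :
    q q' / mmul q q' >-> q * q'} by move=> q q'; rewrite malgUM mulr1.
have big_U := big_morph _ prodU (erefl : << mone >> = 1).
have -> : \prod_(a <- finsupp m) varA K (iota a) ^+ m a = << rename_monom m >>.
  rewrite big_U; apply: eq_bigr => a _.
  by rewrite big_U prodr_const card_ord.
by rewrite malgUM mulr1 mul1m.
Qed.

Lemma scaled_renameE d q p :
  << d *g q >> * rename iota p =
  \sum_(m <- msupp p) << d * p@_m *g mmul q (rename_monom m) >>.
Proof.
by rewrite renameE mulr_sumr; apply: eq_bigr => m _; rewrite malgUM.
Qed.

(** Renaming and multiplication by [q] are injective on monomials, so no two terms of [p] merge. *)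
Lemma mcoeff_scaled_rename d q p m :
  (<< d *g q >> * rename iota p)@_(mmul q (rename_monom m)) = d * p@_m.
Proof.
rewrite scaled_renameE raddf_sum /=.
rewrite (eq_bigr (fun k => if k == m then d * p@_m else 0)); last first.
  move=> k _; rewrite mcoeffU (inj_eq (@mmul_inj _ _)) (inj_eq (@rename_monom_inj)).
  by case: eqP => [->|].
have [mp|mp] := boolP (m \in msupp p).
  rewrite (big_fsetD1 m) //= eqxx big1_seq ?addr0 // => k /=.
  by rewrite !inE => /andP[/negPf->].
rewrite big1_seq => [|k /= kp]; first by rewrite mcoeff_outdom ?mulr0.
by case: eqP => // ekm; rewrite -ekm kp in mp.
Qed.

Lemma mcoeff_scaled_rename_neq0 d q p k :
  (<< d *g q >> * rename iota p)@_k != 0 ->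
  exists2 m, k = mmul q (rename_monom m) & p@_m != 0.
Proof.
rewrite scaled_renameE raddf_sum /= => neq0; apply: contrapT => nok.
move: neq0; rewrite big1_seq ?eqxx // => m /= mp; rewrite mcoeffU.
have [eqk|_] := eqVneq; last by rewrite mulr0n.
by case: nok; exists m; rewrite ?mcoeff_neq0.
Qed.

(** Off the range of [iota] the renamed monomial has exponent 0, so the subtraction in [divcm] is
    nowhere truncated. *)
Lemma rename_monom_dvd m m' :
  (forall a, (m a <= m' (iota a))%N) -> exists q, m' = mmul q (rename_monom m).
Proof.
move=> le_m; exists (divcm m' (rename_monom m)); apply/eqP/cmP => b.
rewrite cmM divcmE subnK //.
have [/eqP->//|/rename_monom_neq0[a -> _]] := boolP (rename_monom m b == 0)%N.
by rewrite rename_monom_image.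
Qed.

End Renaming.

(** The coefficient at [m] may vanish, so the bound survives cancellation of leading terms. *)
Definition mbounded (A : choiceType) (K : nzRingType) (leA : rel A)
    (V : {fset A}) (m : {cmonom A}) (p : {malg K[{cmonom A}]}) : Prop :=
  forall k, p@_k != 0 -> {subset finsupp k <= V} /\ (k = m \/ mlt leA k m).

(** * Bounds on monomials under sums and renaming *)

Section Bounded.
Context (A : countType) (K : comNzRingType) (leA : rel A).
Implicit Types (V : {fset A}) (m q : {cmonom A}) (p : {malg K[{cmonom A}]}).

Lemma mboundedB V m p p' :
  mbounded leA V m p -> mbounded leA V m p' -> mbounded leA V m (p - p').
Proof.
move=> pV p'V k; rewrite mcoeffB => neq0.
have [pk0|/pV//] := eqVneq p@_k 0; apply: p'V.
by apply: contraNneq neq0 => p'k0; rewrite pk0 p'k0 subr0.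
Qed.

Lemma mbounded_sum V m n (F : 'I_n -> {malg K[{cmonom A}]}) :
  (forall i, mbounded leA V m (F i)) -> mbounded leA V m (\sum_(i < n) F i).
Proof.
move=> FV k; rewrite raddf_sum /= => neq0.
have [[i /FV//]|nok] := pselect (exists i, (F i)@_k != 0).
case/negP: neq0; rewrite big1 // => i _; apply: contra_notP nok => /eqP.
by exists i.
Qed.

(** Monotone renaming and multiplication by [q] both preserve [mlt]. *)
Lemma mbounded_scaled_rename (iota : A -> A) V V' d m q p :
  injective iota -> {mono iota : a b / leA a b} ->
  (forall a, a \in V -> iota a \in V') -> {subset finsupp q <= V'} ->
  mbounded leA V m p ->
  mbounded leA V' (mmul q (rename_monom iota m)) (<< d *g q >> * rename iota p).
Proof.
move=> iota_inj iota_mono VV' qV' pV k /mcoeff_scaled_rename_neq0[k' ->].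
move=> /pV[k'V le_k']; split=> [b|].
  rewrite mdomD inE => /orP[/qV'//|]; rewrite -cmE_neq0.
  by move=> /(rename_monom_neq0 iota_inj)[a -> ]; rewrite cmE_neq0 => /k'V/VV'.
case: le_k' => [->|lt_k']; [by left|right].
have [a [lt_a eqm]] := rename_monom_mlt iota_inj iota_mono lt_k'.
exists a; rewrite !cmM ltn_add2l; split=> // b neq ab.
by rewrite !cmM eqm.
Qed.

End Bounded.

(** * Equivariant generation *)

Section Generated.
Context (K : comNzRingType) (A : countType) (S : relStructure A).
Implicit Types (B : polyA K A -> Prop) (f g : polyA K A).

(** The representation demanded by [equivariant_basis], isolated so that it can be negated. *)
Definition generated B f : Prop :=
  exists (n : nat) (h g : 'I_n -> polyA K A) (iota : 'I_n -> A -> A),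
    [/\ forall i, B (g i),
        forall i, is_embedding S (iota i)
      & f = \sum_(i < n) h i * rename (iota i) (g i)].

Lemma generated0 B : generated B 0.
Proof.
by exists 0%N, (fun=> 0), (fun=> 0), (fun=> id); split=> [[]|[]|]; rewrite ?big_ord0.
Qed.

Lemma generatedD B f f' : generated B f -> generated B f' -> generated B (f + f').
Proof.
move=> [n [h [g [iota [Bg emb ->]]]]] [n' [h' [g' [iota' [Bg' emb' ->]]]]].
pose glue T (u : 'I_n -> T) (u' : 'I_n' -> T) (i : 'I_(n + n')) :=
  match split i with inl j => u j | inr j => u' j end.
have glueL T u u' j : glue T u u' (lshift n' j) = u j.
  by rewrite /glue (unsplitK (inl j)).
have glueR T u u' j : glue T u u' (rshift n j) = u' j.
  by rewrite /glue (unsplitK (inr j)).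
exists (n + n')%N, (glue _ h h'), (glue _ g g'), (glue _ iota iota').
split=> [i|i|]; [by rewrite /glue; case: split..|].
rewrite big_split_ord; apply: congr2; apply: eq_bigr => i _.
  by rewrite !glueL.
by rewrite !glueR.
Qed.

Lemma generated_scaled B h g iota :
  B g -> is_embedding S iota -> generated B (h * rename iota g).
Proof.
move=> Bg emb; exists 1%N, (fun=> h), (fun=> g), (fun=> iota).
by split=> //; rewrite big_ord1.
Qed.

End Generated.

(** * Leading monomials and their minimality *)

Section LeadingMonomial.
Context (A : countType) (K : comNzRingType) (leA : rel A).
Hypotheses (leA_total : total leA) (leA_trans : transitive leA).
Hypothesis leA_anti : antisymmetric leA.
Implicit Types (V : {fset A}) (m : {cmonom A}) (p : polyA K A).

Lemma leading_monom V p : p != 0 ->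
  (forall k, p@_k != 0 -> {subset finsupp k <= V}) ->
  exists2 m, p@_m != 0 & mbounded leA V m p.
Proof.
rewrite -msupp_eq0 => p0 pV.
have [|m mp m_max] := mlt_max leA_total leA_trans leA_anti (s := msupp p).
  by apply: contraNneq p0 => eqp; rewrite -cardfs_eq0 eqp.
exists m; first by rewrite mcoeff_neq0.
by move=> k pk; split; [apply: pV | apply: m_max; rewrite -mcoeff_neq0].
Qed.

(** All competitors share [V], which may exceed the set of variables of [p]. *)
Definition least_leading (Q : polyA K A -> Prop) V m p : Prop :=
  [/\ Q p, p@_m != 0, mbounded leA V m p
    & forall p' m', Q p' -> p'@_m' != 0 -> mbounded leA V m' p' ->
      ~ mlt leA m' m].

(* The order on monomials is not well-founded when A has infinite descending
   chains, hence the restriction to a finite set V of variables. *)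
Lemma least_leading_exists (Q : polyA K A -> Prop) :
  ~ Q 0 -> (exists p, Q p) -> exists V m p, least_leading Q V m p.
Proof.
move=> Q0 [p Qp]; pose V := (\bigcup_(m <- msupp p) finsupp m)%fset.
have pV k : p@_k != 0 -> {subset finsupp k <= V}.
  by move=> pk a ak; apply/bigfcupP; exists k; rewrite // -mcoeff_neq0 pk.
have [|m pm mp] := leading_monom _ pV.
  by apply: contra_notN Q0 => /eqP <-.
pose P m := exists p', [/\ Q p', p'@_m != 0 & mbounded leA V m p'].
have [||m' [p' [Qp' p'm' m'p']] min_m'] :=
    mlt_min leA_total leA_trans (V := V) (P := P).
- by exists m, p.
- by move=> k [p' [_ p'k /(_ k p'k)[]]].
exists V, m', p'; split=> // p1 m1 Qp1 p1m1 m1p1.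
by apply: min_m'; exists p1.
Qed.

End LeadingMonomial.

(** * From labellings to divisibility, and the final contradiction *)

Lemma lab_le_finsupp (A : countType) (S : relStructure A) (V V' : {fset A})
    (m m' : {cmonom A}) :
  {subset finsupp m <= V} ->
  lab_le S [fmap b : V => m (val b)] [fmap b : V' => m' (val b)] ->
  exists iota, [/\ is_embedding S iota, forall a, a \in V -> iota a \in V'
    & forall a, (m a <= m' (iota a))%N].
Proof.
move=> mV [iota emb le_lab]; exists iota; split=> // a => [aV|].
  by have [] := le_lab [` aV]%fset.
have [aV|aV] := boolP (a \in V).
  by have [ib] := le_lab [` aV]%fset; rewrite !ffunE.
suff /eqP-> : m a == 0%N by [].
by rewrite cmE_eq0; apply: contra aV => /mV.
Qed.

Theorem theorem3p2 (A : countType) (S : relStructure A) (K : comNzRingType)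
    (eq_definable : definable2 S (fun x y : A => x = y))
    (S_ws : omega_well_structured S)
    (S_tot : totally_ordered S)
    (K_noeth : noetherian K) :
  equivariantly_noetherian K S.
Proof.
have [le [[_ le_anti le_trans le_total] le_def]] := S_tot.
pose leA : rel A := fun x y => `[< le x y >].
have leA_total : total leA.
  by move=> x y; apply/orP; have [] := le_total x y => /asboolP; auto.
have leA_trans : transitive leA.
  by move=> y x z /asboolP xy /asboolP yz; apply/asboolP/le_trans/yz.
have leA_anti : antisymmetric leA.
  by move=> x y /andP[/asboolP xy /asboolP yx]; apply: le_anti.
have emb_mono iota : is_embedding S iota -> {mono iota : a b / leA a b}.
  by move=> emb a b; apply/asbool_equiv_eq/(definable2_embedding emb).
have emb_inj iota : is_embedding S iota -> injective iota.
  by move=> emb a b; apply: (definable2_embedding emb a b eq_definable).1.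
move=> I [[I0 ID IM] Iren]; apply: contrapT => noB.
pose Q (s : seq (polyA K A)) f := I f /\ ~ generated S (fun g => g \in s) f.
have step s : exists t : {fset A} * {cmonom A} * polyA K A,
    (forall g, g \in s -> I g) -> least_leading leA (Q s) t.1.1 t.1.2 t.2.
  have [sI|nsI] := pselect (forall g, g \in s -> I g); last first.
    (* A default value; by [prefixI] the construction only meets lists in [I]. *)
    by exists (fset0, mone, 0).
  have [|| V [m [f fP]]] := least_leading_exists leA_total leA_trans leA_anti (Q := Q s).
  - by case=> _; apply; apply: generated0.
  - apply: contrapT => noQ; apply: noB; exists s; split=> // f If.
    by apply: contrapT => nogen; apply: noQ; exists f.
  by exists (V, m, f).
have [nxt nxtP] := choice step.
(* The first [n] chosen polynomials, latest first. *)
pose prefix := fix prefix n :=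
  if n is n'.+1 then (nxt (prefix n')).2 :: prefix n' else [::].
have prefixI n g : g \in prefix n -> I g.
  elim: n g => // n IHn g; rewrite inE => /predU1P[->|/IHn//].
  by have [[]] := nxtP _ IHn.
pose V n := (nxt (prefix n)).1.1; pose m n := (nxt (prefix n)).1.2.
pose f n := (nxt (prefix n)).2.
have fP n : least_leading leA (Q (prefix n)) (V n) (m n) (f n).
  exact/nxtP/prefixI.
have f_prefix i j : (i < j)%N -> f i \in prefix j.
  elim: j => // j IHj; rewrite ltnS leq_eqVlt inE => /predU1P[->|/IHj->].
    by rewrite eqxx.
  by rewrite orbT.
have mV n : {subset finsupp (m n) <= V n}.
  by have [_ fm /(_ _ fm)[]] := fP n.
(* The labels cover all of [V n], with zeros outside the support of [m n]: the embedding must also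
   carry the variables of the lower terms into the later set. *)
have [sg sgP] := wqo_increasing_subsequence S_ws
  (fun n => [fmap b : V n => m n (val b)]).
have [n [d lead_eq]] := noetherian_sequence (fun i => (f (sg i))@_(m (sg i))) K_noeth.
have quo (i : 'I_n) : exists t : (A -> A) * {cmonom A},
    [/\ is_embedding S t.1, forall a, a \in V (sg i) -> t.1 a \in V (sg n)
      & m (sg n) = mmul t.2 (rename_monom t.1 (m (sg i)))].
  have [_ /(lab_le_finsupp (mV _))[iota [emb iotaV le_m]]] := sgP i n (ltn_ord i).
  have [q eqq] := rename_monom_dvd (emb_inj _ emb) le_m.
  by exists (iota, q).
have [t tP] := choice quo.
(* Each [F i] is bounded by [m (sg n)], with coefficient there [d i] times the leading coefficient
   of [f (sg i)]. *)
pose F (i : 'I_n) : polyA K A :=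
  << d i *g (t i).2 >> * rename (t i).1 (f (sg i)).
pose r := f (sg n) - \sum_(i < n) F i.
have [[If ngf] fm mf min_f] := fP (sg n).
have Fgen i : generated S (fun g => g \in prefix (sg n)) (F i).
  have [emb _ _] := tP i; apply: generated_scaled => //.
  by apply/f_prefix; have [] := sgP i n (ltn_ord i).
have Qr : Q (prefix (sg n)) r.
  have FI : I (\sum_(i < n) F i).
    apply: big_ind => // i _; apply/IM/Iren; first by have [] := tP i.
    by have [[]] := fP (sg i).
  split; first by rewrite /r -mulN1r; apply/ID/IM/FI.
  (* If [r] were generated, adding back the generated [F i] would generate [f (sg n)]. *)
  move=> rgen; apply: ngf; rewrite -(subrK (\sum_(i < n) F i) (f (sg n))).
  apply: generatedD => //; apply: big_ind => //; first exact: generated0.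
  exact: generatedD.
have mr : mbounded leA (V (sg n)) (m (sg n)) r.
  apply: mboundedB => //; apply: mbounded_sum => i.
  have [emb iotaV eqm] := tP i; rewrite eqm.
  have [_ _ mfi _] := fP (sg i).
  apply: mbounded_scaled_rename mfi => //; first exact: emb_inj.
    exact: emb_mono.
  by move=> a aq; apply: mV; rewrite eqm mdomD inE aq.
have rm : r@_(m (sg n)) = 0.
  rewrite mcoeffB raddf_sum /= lead_eq -sumrB big1 // => i _.
  have [emb _ eqm] := tP i; rewrite {1}eqm mcoeff_scaled_rename ?subrr //.
  exact: emb_inj.
(* As 0 is generated, [r] is nonzero. Its leading monomial [k] differs from [m (sg n)], where the
   coefficient vanishes, hence is smaller, against minimality. *)
have [|k rk kr] := leading_monom leA_total leA_trans leA_anti _ (fun k rk => (mr k rk).1).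
  apply: contra_not_neq Qr.2 => ->; exact: generated0.
apply: (min_f r k) => //; have [_ [ekm|//]] := mr k rk.
by rewrite ekm rm eqxx in rk.
Qed.
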